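(* For every $q,k\ge1$, $\mathcal B_{q,k}=V_{q,k}$. A linear summary of $k$-boundary module responses (a linear map on $\mathcal B_{q,k}$) that supports every finite physical continuation must be injective on this space. Its minimal dimension is $\#(S_q^k/\Gamma_q)$.
   Context: Fix a spectral moment order $q\ge1$; $\Omega_q=S_q$ is the symmetric group. For a positive nonzero finite-rank operator $Q$, $f_{Q,q}(\pi)=\prod_{a\in\operatorname{Cycles}(\pi)}\operatorname{Tr}(Q^{|a|})$, a strictly positive class function on $S_q$. A finite physical module with $k$ boundary vertices is a finite loopless graph $G$ (parallel edges allowed) with vertex set $B\sqcup I$, $B$ an ordered set of $k$ boundary vertices, $I$ internal vertices, each edge $b$ carrying a nonzero finite-rank positive operator $Q_b$ (arbitrary spectrum). Its response is the function on $S_q^B\cong S_q^k$ $$H_{G,q}(\pi_B)=\sum_{\pi_I\in S_q^I}\ \prod_{b=\{u,v\}}f_{Q_b,q}(\pi_u^{-1}\pi_v).$$ $\mathcal B_{q,k}$ is the real linear span of all responses of finite physical modules with $k$ ordered boundary vertices. $\kappa(x,y)$ denotes the cycle type of $x^{-1}y$ and $\Gamma_q=\{\gamma\in\operatorname{Sym}(\Omega_q):\kappa(\gamma x,\gamma y)=\kappa(x,y)\ \forall x,y\in\Omega_q\}$, acting diagonally on $\Omega_q^k$. $V_{q,k}=\mathbb R^{\Omega_q^k/\Gamma_q}$ is the space of real $\Gamma_q$-invariant functions on $\Omega_q^k$. A finite physical continuation of a $k$-boundary module is obtained by gluing to its boundary vertices another finite physical module $G'$ sharing those $k$ vertices (and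 possibly having further vertices), choosing two distinct vertices $c,e$ of $G'$ (boundary or not) as anchors, fixing the labels $\pi_c=\tau_q$ (the full cycle $(1\,2\cdots q)$) and $\pi_e=\operatorname{Id}$, multiplying the two edge weights, and summing over the labels in $S_q$ of all other vertices (up to the known normalization factor $1/q!$ per summed vertex). The resulting scalar reading is a linear functional of the response $H_{G,q}$. A linear map $\Lambda$ on $\mathcal B_{q,k}$ supports every finite physical continuation if every such reading factors through $\Lambda$; its dimension is the dimension of its range. *)

(* Defs.v *)
From HB Require Import structures.
From mathcomp Require Import all_boot all_order all_algebra all_fingroup.
From mathcomp Require Import boolp reals complex.

Set Implicit Arguments.
Unset Strict Implicit.
Unset Printing Implicit Defensive.

Import Order.TTheory GRing.Theory Num.Theory.
Local Open Scope ring_scope.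
Local Open Scope complex_scope.
Local Open Scope sesquilinear_scope.

(* A finite-rank positive operator on a complex Hilbert space vanishes on the
   orthogonal complement of its range, so up to unitary equivalence and a zero
   summand it is a positive semidefinite complex matrix of some size; the
   traces of its powers are those of the matrix. Vectors are rows. *)
Record posop (R : realType) := PosOp {
  opdim : nat;
  opmx :> 'M[R[i]]_opdim;
  opmx_herm : opmx \is hermsymmx;
  opmx_ge0 : forall v : 'rV[R[i]]_opdim, 0 <= (v *m opmx *m v ^t*) 0 0;
  opmx_neq0 : opmx != 0 }.

Section Weights.
Variables (R : realType) (q : nat).

(* The trace of a power of a positive operator is a nonnegative real; Re only
   moves it from R[i] to R. [porbits] includes the fixed points as cycles. *)
Definition fweight (Q : posop R) (s : 'S_q) : R :=
  \prod_(a in porbits s) complex.Re (\tr (opmx Q ^+ #|a|)).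

Definition full_cycle : 'S_q := perm (@ordS_inj q).

Definition cycle_type (s : 'S_q) : seq nat :=
  sort geq [seq #|a| | a : {set 'I_q} in porbits s].

(* In MathComp x^-1 * y applies x^-1 first; the other order of composition
   gives a conjugate permutation, with the same cycle type and fweight. *)
Definition kappa (x y : 'S_q) : seq nat := cycle_type (x^-1 * y)%g.

Definition Gamma : {set {perm 'S_q}} :=
  [set g : {perm 'S_q} | [forall x, forall y, kappa (g x) (g y) == kappa x y]].

Lemma group_set_Gamma : group_set Gamma.
Proof.
apply/group_setP; split=> [|g h].
  by rewrite inE; apply/forallP=> x; apply/forallP=> y; rewrite !perm1.
rewrite !inE => /forallP gP /forallP hP.
apply/forallP=> x; apply/forallP=> y; rewrite !permM.
by rewrite (eqP (forallP (hP _) _)) (eqP (forallP (gP _) _)).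
Qed.
Canonical Gamma_group := Group group_set_Gamma.

End Weights.

Notation labelling q V := {ffun V -> 'S_q}.

Section DiagonalAction.
Variables (q k : nat).

Definition diag (p : labelling q 'I_k) (g : {perm 'S_q}) : labelling q 'I_k :=
  [ffun i => g (p i)].

Lemma diag_is_action : is_action setT diag.
Proof.
apply: is_total_action => [p|p g h]; apply/ffunP=> i; rewrite !ffunE ?perm1 //.
by rewrite permM.
Qed.
Canonical diag_action := Action diag_is_action.

Definition boundary_orbits : {set {set labelling q 'I_k}} :=
  [set orbit diag_action (Gamma q) p | p : labelling q 'I_k].

End DiagonalAction.

(* The vertices are the k ordered boundary vertices (inl) and the internal
   ones (inr). Edges are an arbitrary finite type, so that they may be
   parallel. The order of the two ends of an edge is a mere encoding: fweight
   takes the same value at a permutation and at its inverse. *)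
Record physmod (R : realType) (k : nat) := PhysMod {
  inner : finType;
  edge : finType;
  ends : edge -> ('I_k + inner) * ('I_k + inner);
  loopless : forall b, (ends b).1 != (ends b).2;
  eop : edge -> posop R }.

Definition vertex (R : realType) k (G : physmod R k) : finType :=
  ('I_k + inner G)%type.

Section Modules.
Variables (R : realType) (q k : nat).
Implicit Type G : physmod R k.

Definition edge_weight G (s : vertex G -> 'S_q) : R :=
  \prod_b fweight (eop b) ((s (ends b).1)^-1 * s (ends b).2)%g.

Definition join_labels G (p : labelling q 'I_k) (t : labelling q (inner G))
    (v : vertex G) : 'S_q :=
  match v with inl i => p i | inr j => t j end.

Local Notation bfun := {ffun labelling q 'I_k -> R^o}.

Definition response G : bfun :=
  [ffun p => \sum_(t : labelling q (inner G)) edge_weight (join_labels p t)].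

Definition response_span : {pred bfun} := fun h =>
  `[< exists (n : nat) (c : 'I_n -> R) (G : 'I_n -> physmod R k),
      h = \sum_i c i *: response (G i) >].

Definition invariant_functions : {pred bfun} := fun h =>
  [forall g in Gamma q, forall p, h (diag p g) == h p].

Lemma response_in_span G : response G \in response_span.
Proof.
apply/asboolP; exists 1%N, (fun=> 1), (fun=> G).
by rewrite big_ord1 scale1r.
Qed.

Lemma response_span_submod_closed : submod_closed response_span.
Proof.
split=> [|a f g /asboolP[n [c [G ->]]] /asboolP[m [d [H ->]]]].
  apply/asboolP; exists 0%N, (fun=> 0), (fun i : 'I_0 => False_rect _ (notF (ltn_ord i))).
  by rewrite big_ord0.
apply/asboolP; exists (n + m)%N.
exists (fun i => match split i with inl j => a * c j | inr j => d j end).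
exists (fun i => match split i with inl j => G j | inr j => H j end).
rewrite big_split_ord scaler_sumr; congr (_ + _); apply: eq_bigr => i _.
  by rewrite (unsplitK (inl i)) scalerA.
by rewrite (unsplitK (inr i)).
Qed.
HB.instance Definition _ :=
  GRing.isSubmodClosed.Build R bfun response_span response_span_submod_closed.

Record response_space := ResponseSpace {
  response_val :> bfun;
  response_valP : response_val \in response_span }.
HB.instance Definition _ := [isSub for response_val].
HB.instance Definition _ := [Choice of response_space by <:].
HB.instance Definition _ :=
  [SubChoice_isSubLmodule of response_space by <:].

Definition Response G : response_space := ResponseSpace (response_in_span G).

End Modules.

Arguments response_span : clear implicits.
Arguments invariant_functions : clear implicits.

Section Gluing.
Variables (R : realType) (k : nat) (G H : physmod R k).

Definition glueL (v : vertex G) : 'I_k + (inner G + inner H) :=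
  match v with inl i => inl i | inr j => inr (inl j) end.
Definition glueR (v : vertex H) : 'I_k + (inner G + inner H) :=
  match v with inl i => inl i | inr j => inr (inr j) end.

Definition glue_ends (b : edge G + edge H) :=
  match b with
  | inl b => (glueL (ends b).1, glueL (ends b).2)
  | inr b => (glueR (ends b).1, glueR (ends b).2)
  end.

Lemma glue_loopless b : (glue_ends b).1 != (glue_ends b).2.
Proof.
case: b => b /=; have := loopless b; apply: contra_neq.
  by case: (ends b) => [[x|x] [y|y]] //= [] ->.
by case: (ends b) => [[x|x] [y|y]] //= [] ->.
Qed.

Definition glue : physmod R k :=
  PhysMod glue_loopless
    (fun b => match b with inl b => eop b | inr b => eop b end).

End Gluing.

Section Readings.
Variables (R : realType) (q k : nat).

Definition anchored_sum (G : physmod R k) (c e : vertex G) : R :=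
  \sum_(s : labelling q (vertex G) | (s c == full_cycle q) && (s e == 1%g))
    edge_weight s.

(* The nonzero factor 1/q! per summed vertex is left out: it does not affect
   which linear maps the reading factors through. *)
Definition reading (G H : physmod R k) (c e : vertex H) : R :=
  anchored_sum (glueR G c : vertex (glue G H)) (glueR G e).

Definition reading_form (H : physmod R k) (c e : vertex H)
    (h : {ffun labelling q 'I_k -> R^o}) : R :=
  \sum_(s : labelling q (vertex H) | (s c == full_cycle q) && (s e == 1%g))
    h [ffun i => s (inl i)] * edge_weight s.

Lemma readingE (G H : physmod R k) (c e : vertex H) :
  reading G c e = reading_form c e (response q G).
Proof.
rewrite /reading /anchored_sum /reading_form.
under [RHS]eq_bigr => s _ do rewrite ffunE mulr_suml.
rewrite pair_big /=.
pose join (x : labelling q (vertex H) * labelling q (inner G)) :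
    labelling q (vertex (glue G H)) :=
  [ffun v => match v with
    | inl i => x.1 (inl i) | inr (inl j) => x.2 j | inr (inr j) => x.1 (inr j)
    end].
pose part (s : labelling q (vertex (glue G H))) :=
  ([ffun v => s (glueR G v)] : labelling q (vertex H),
   [ffun j => s (inr (inl j))] : labelling q (inner G)).
have joinK : cancel join part.
  move=> [s t]; congr (_, _); apply/ffunP => v; rewrite !ffunE //.
  by case: v.
have partK : cancel part join.
  by move=> s; apply/ffunP => -[i|[j|j]]; rewrite !ffunE.
have joinR x v : join x (glueR G v) = x.1 v by rewrite ffunE; case: v.
have joinL x v : join x (glueL H v) =
    join_labels [ffun i => x.1 (inl i)] x.2 v.
  by case: v => v; rewrite ffunE /= ?ffunE.
rewrite (reindex join) /=; last by exists part => ? _.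
apply: eq_big => [x|x _]; first by rewrite !joinR andbT.
rewrite /edge_weight big_sumType /=; congr (_ * _); apply: eq_bigr => b _ /=.
  by rewrite !joinL.
by rewrite !joinR.
Qed.

Definition supports_continuations (W : lmodType R)
    (L : {linear response_space R q k -> W}) : Prop :=
  forall (H : physmod R k) (c e : vertex H), c != e ->
  exists l : {linear W -> R^o}, forall G : physmod R k,
    l (L (Response q G)) = reading G c e.

End Readings.

(* The range of L has a basis of n vectors. *)
Definition range_dim (R : realType) (U W : lmodType R) (L : {linear U -> W})
    (n : nat) : Prop :=
  exists w : 'I_n -> W,
  [/\ forall i, exists u, w i = L u,
      forall a : 'I_n -> R, \sum_i a i *: w i = 0 -> forall i, a i = 0
    & forall u, exists a : 'I_n -> R, L u = \sum_i a i *: w i].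

(* Main.v *)
Require Import Defs.
From HB Require Import structures.
From mathcomp Require Import all_boot all_order all_algebra all_fingroup.
From mathcomp Require Import boolp reals complex.
From mathcomp Require Import ring.
Import Order.TTheory GRing.Theory Num.Theory.
Local Open Scope ring_scope.
Local Open Scope sesquilinear_scope.

Set Implicit Arguments.
Unset Strict Implicit.
Unset Printing Implicit Defensive.

(** The heart of the matter is one family of modules that reads off the action
    of Gamma on labels.

    Operators of spectrum (1, n) have weight the product of 1 + n ^ a over the
    cycle lengths a. As polynomials in n these products determine the multiset
    of lengths, so any two cycle types are separated by some weight
    ([fweight_separates]), and a product of affine functions of weights is the
    indicator of a given cycle type ([cycle_type_indicator]). Factors of the
    product are realised by parallel edges, and linear combinations of weights
    on the edges expand into linear combinations of modules
    ([multilinear_expansion]).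

    Take now one internal vertex for each permutation x, and ask that the
    labels at x and y be in the same relative cycle type as x and y themselves.
    Since only the identity has its cycle type, such a labelling is injective,
    hence it is exactly an element of Gamma. Joining further vertices to the
    chosen permutations by edges that force equal labels, the sum over all
    labellings collapses to a sum over Gamma ([gadget_sum]).

    When only the boundary vertices are joined, at the permutations of a
    boundary labelling p, the response counts the elements of Gamma that carry
    p to the argument; averaging over p recovers every invariant function
    ([response_spanE]). When two anchors are joined as well, at the full cycle
    and at the identity, the combined reading of an invariant function h is
    h p times the number of elements of Gamma that fix both permutations, a
    positive number; so a summary that supports all readings kills only 0
    ([supports_injective]). The dimension is then that of the invariant
    functions, which have the indicators of the orbits as a basis. *)

(** * Cycle types *)

Lemma cycle_type_gt0 q (s : 'S_q) : {in cycle_type s, forall a, (0 < a)%N}.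
Proof.
move=> a; rewrite mem_sort => /mapP[A].
rewrite mem_enum => /imsetP[x _ ->] ->.
by apply/card_gt0P; exists x; apply: porbit_id.
Qed.

Lemma cycle_type_eq1 q (s : 'S_q) :
  cycle_type s = cycle_type (1%g : 'S_q) -> s = 1%g.
Proof.
move=> eq_s1; apply/permP => x; rewrite perm1.
have : #|porbit s x| \in cycle_type s.
  by rewrite mem_sort; apply: map_f; rewrite mem_enum; apply: imset_f.
rewrite eq_s1 mem_sort => /mapP[A]; rewrite mem_enum => /imsetP[y _ ->].
have -> : porbit 1 y = [set y].
  apply/setP => z; rewrite inE porbit_sym.
  apply/porbitP/eqP => [[i ->]|->]; first by rewrite expg1n perm1.
  by exists 0%N; rewrite expg0 perm1.
rewrite cards1 => /eqP/cards1P[z eq_z].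
have := mem_porbit s 1 x; have := porbit_id s x.
by rewrite eq_z expg1 !inE => /eqP -> /eqP.
Qed.

Lemma cycle_type_mulV_eq1 q (x y : 'S_q) :
  (cycle_type (x^-1 * y)%g == cycle_type (1%g : 'S_q)) = (x == y).
Proof.
apply/eqP/eqP => [/cycle_type_eq1|->]; last by rewrite mulVg.
by move=> eq1; apply/eqP; rewrite eq_mulVg1 eq1.
Qed.

Lemma fweightE (R : realType) q (Q : posop R) (s : 'S_q) :
  fweight Q s = \prod_(a <- cycle_type s) complex.Re (\tr (opmx Q ^+ a)).
Proof.
rewrite /fweight /cycle_type (perm_big _ (permEl (perm_sort _ _))) /=.
by rewrite big_map big_enum.
Qed.

Lemma eq_fweight (R : realType) q (Q : posop R) (s t : 'S_q) :
  cycle_type s = cycle_type t -> fweight Q s = fweight Q t.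
Proof. by rewrite !fweightE => ->. Qed.

(** * Weights separate cycle types *)

Section TwoLevel.
Variables (R : realType) (n : nat).

Definition two_level_mx : 'M[R[i]]_2 :=
  diag_mx (\row_i (if i == 0 then 1%N else n)%:R).

Lemma two_level_herm : two_level_mx \is hermsymmx.
Proof.
apply/is_hermitianmxP/matrixP => i j; rewrite expr0 scale1r !mxE.
rewrite (eq_sym j i); case: (eqVneq i j) => [->|_].
  by rewrite !mulr1n conjC_nat.
by rewrite !mulr0n conjC0.
Qed.

Lemma two_level_ge0 (v : 'rV[R[i]]_2) : 0 <= (v *m two_level_mx *m v ^t*) 0 0.
Proof.
rewrite mul_mx_diag mxE; apply: sumr_ge0 => i _; rewrite !mxE.
by rewrite mulrAC mulr_ge0 ?ler0n ?mul_conjC_ge0.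
Qed.

Lemma two_level_neq0 : two_level_mx != 0.
Proof. by apply/eqP => /matrixP/(_ 0 0)/eqP; rewrite !mxE /= oner_eq0. Qed.

Definition two_level : posop R :=
  PosOp two_level_herm two_level_ge0 two_level_neq0.

Lemma two_level_trace a :
  complex.Re (\tr (opmx two_level ^+ a)) = 1 + n%:R ^+ a.
Proof.
have -> : opmx two_level ^+ a =
    diag_mx (\row_i (if i == 0 then 1%N else n)%:R ^+ a).
  elim: a => [|a IHa].
    by apply/matrixP=> i j; rewrite !mxE expr0.
  rewrite exprS IHa /= [LHS]mulmx_diag; congr diag_mx.
  by apply/rowP => i; rewrite !mxE exprS.
rewrite mxtrace_diag !big_ord_recl big_ord0 !mxE /= expr1n addr0.
by rewrite -natrX -!(rmorph_nat (real_complex R)) -rmorphD /= natrX.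
Qed.

End TwoLevel.

(** When all the exponents are at least m, the first nonconstant coefficient
    of the product of the 1 + x ^ a counts the exponents equal to m. *)
Lemma prod_binomial_low (A : comRingType) (x : A) m (s : seq nat) :
  (0 < m)%N -> {in s, forall a, (m <= a)%N} ->
  exists r, \prod_(a <- s) (1 + x ^+ a) =
    1 + (count_mem m s)%:R * x ^+ m + x ^+ m.+1 * r.
Proof.
case: m => // m _; elim: s => [|a s IHs] ge_m.
  by exists 0; rewrite big_nil mul0r mulr0 !addr0.
have [|r eq_r] := IHs; first by move=> b b_s; apply: ge_m; rewrite inE b_s orbT.
have : (m < a)%N by apply: ge_m; rewrite mem_head.
rewrite big_cons eq_r /= leq_eqVlt => /predU1P[<-|/subnKC <-].
  exists ((count_mem m.+1 s)%:R * x ^+ m + r * (1 + x ^+ m.+1)).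
  by rewrite eqxx natrD mulr1n !exprS; ring.
set j := (a - m.+2)%N.
exists (r + x ^+ j * (1 + (count_mem m.+1 s)%:R * x ^+ m.+1 + x ^+ m.+2 * r)).
rewrite gtn_eqF ?ltnS ?leq_addr // add0n exprD !exprS; ring.
Qed.

(** The coefficient of degree m, the least exponent on either side, counts m in
    s and in t alike. So m occurs in both, and the factor 1 + 'X^m cancels. *)
Lemma prod_binomial_inj (R : numDomainType) (s t : seq nat) :
  {in s, forall a, (0 < a)%N} -> {in t, forall a, (0 < a)%N} ->
  \prod_(a <- s) (1 + 'X^a) = \prod_(a <- t) (1 + 'X^a) :> {poly R} ->
  perm_eq s t.
Proof.
have [n] := ubnP (size s); elim: n s t => // n IHn s t le_n s_gt0 t_gt0 eq_st.
have [/eqP|[m0 m0_in]] : s ++ t = [::] \/ exists m, m \in s ++ t.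
- by case: (s ++ t) => [|m u]; [left | right; exists m; apply: mem_head].
- by rewrite -size_eq0 size_cat addn_eq0 => /andP[/nilP-> /nilP->].
case: (ex_minnP (ex_intro (fun m => m \in s ++ t) m0 m0_in)) => m.
rewrite mem_cat => m_in m_min.
have m_gt0 : (0 < m)%N by case/orP: m_in => [/s_gt0|/t_gt0].
have [a a_s|r eq_r] := prod_binomial_low ('X : {poly R}) m_gt0 (s := s).
  by apply: m_min; rewrite mem_cat a_s.
have [a a_t|r' eq_r'] := prod_binomial_low ('X : {poly R}) m_gt0 (s := t).
  by apply: m_min; rewrite mem_cat a_t orbT.
have eq_count : count_mem m s = count_mem m t.
  move: eq_st; rewrite {}eq_r {}eq_r' => /(congr1 (coefp m)) /=.
  rewrite !coefD !coefXnM !ltnSn !addr0 -!polyC_natr !coefCM.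
  rewrite !coefXn eqxx !mulr1.
  by move=> /addrI/eqP; rewrite eqr_nat => /eqP.
have m_s : m \in s by move: m_in; rewrite -!has_pred1 !has_count eq_count orbb.
have m_t : m \in t.
  by rewrite -has_pred1 has_count -eq_count -has_count has_pred1.
rewrite (permPl (perm_to_rem m_s)) (permPr (perm_to_rem m_t)) perm_cons.
apply: IHn => [|a /mem_rem/s_gt0 //|a /mem_rem/t_gt0 //|].
  by rewrite size_rem //; case: (s) m_s le_n.
move: eq_st; rewrite (perm_big _ (perm_to_rem m_s)) /=.
rewrite (perm_big _ (perm_to_rem m_t)) /= !big_cons; apply: mulfI.
apply/eqP => /(congr1 (horner^~ 1))/eqP.
by rewrite !hornerE expr1n (eqr_nat _ 2 0).
Qed.

(** Were the weights equal for all n, the products of the 1 + 'X^a would agree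
    at infinitely many points. *)
Lemma fweight_separates (R : realType) q (s t : 'S_q) :
  cycle_type s != cycle_type t ->
  exists n, fweight (two_level R n) s != fweight (two_level R n) t.
Proof.
apply: contra_neqP => /forallNP no_n.
pose P (u : 'S_q) : {poly R} := \prod_(a <- cycle_type u) (1 + 'X^a).
have PE u n : (P u).[n%:R] = fweight (two_level R n) u.
  rewrite horner_prod fweightE; apply: eq_bigr => a _.
  by rewrite !hornerE two_level_trace.
have eqP_st : P s = P t.
  apply/eqP; rewrite -subr_eq0; apply/negPn/negP => P_neq0.
  pose rs : seq R := [seq n%:R | n <- iota 0 (size (P s - P t))].
  suff : (size rs < size (P s - P t)%R)%N by rewrite size_map size_iota ltnn.
  apply: max_poly_roots P_neq0 _ _.
    apply/allP => _ /mapP[n _ ->]; rewrite /root hornerD hornerN !PE subr_eq0.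
    exact/negPn/negP/no_n.
  rewrite map_inj_uniq ?iota_uniq // => m n /eqP.
  by rewrite eqr_nat => /eqP.
have ct_sorted (u : 'S_q) : sorted geq (cycle_type u).
  by apply: sort_sorted => a b; apply: leq_total.
apply: sorted_eq (ct_sorted s) (ct_sorted t) _.
- by move=> a b c /= b_ge c_ge; apply: leq_trans c_ge b_ge.
- by move=> a b /=; rewrite andbC => /anti_leq.
by apply: prod_binomial_inj eqP_st; apply: cycle_type_gt0.
Qed.

(** * Indicators of cycle types *)

Section CycleTypeIndicator.
Variables (R : realType) (q : nat).
Implicit Types r m s : 'S_q.

Lemma fweight_two_level0 s : fweight (two_level R 0) s = 1.
Proof.
rewrite fweightE big1_seq // => a /andP[_ /cycle_type_gt0 a_gt0].
by rewrite two_level_trace mulr0n expr0n gtn_eqF // addr0.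
Qed.

(** The affine function of a single separating weight; the weight of the
    operator of spectrum (1, 0) is the constant 1. The summation over bool gives
    all the factors the same index type. *)
Lemma separating_factor r m :
  exists (c : bool -> R) (Q : bool -> posop R),
    \sum_j c j * fweight (Q j) r = 1 /\
    (cycle_type m != cycle_type r -> \sum_j c j * fweight (Q j) m = 0).
Proof.
have [eq_mr|neq_mr] := eqVneq (cycle_type m) (cycle_type r).
  exists (fun j => j%:R), (fun=> two_level R 0); split=> //.
  by rewrite big_bool /= !fweight_two_level0 mul0r addr0 mulr1.
have [n] := fweight_separates R neq_mr; rewrite eq_sym -subr_eq0 => d_neq0.
set d := _ - _ in d_neq0.
exists (fun j => if j then d^-1 else - fweight (two_level R n) m / d).
exists (fun j => two_level R (if j then n else 0)).
rewrite !big_bool /= !fweight_two_level0; split=> [|_]; last by field.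
by rewrite /d in d_neq0 *; field.
Qed.

(** The factor of index m is 1 on the cycle type of r, and 0 on that of m if it
    differs; so the factor of index s makes the product vanish when the cycle
    type of s is not that of r. *)
Lemma cycle_type_indicator :
  exists (c : 'S_q -> 'S_q -> bool -> R) (Q : 'S_q -> 'S_q -> bool -> posop R),
    forall r s, \prod_m \sum_j c r m j * fweight (Q r m j) s =
                (cycle_type s == cycle_type r)%:R.
Proof.
have /choice[w wP] (rm : 'S_q * 'S_q) :
    exists w : (bool -> R) * (bool -> posop R),
    \sum_j w.1 j * fweight (w.2 j) rm.1 = 1 /\
    (cycle_type rm.2 != cycle_type rm.1 ->
     \sum_j w.1 j * fweight (w.2 j) rm.2 = 0).
  by have [c [Q cQ]] := separating_factor rm.1 rm.2; exists (c, Q).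
exists (fun r m => (w (r, m)).1), (fun r m => (w (r, m)).2) => r s.
case: eqVneq => [eq_sr|neq_sr].
  apply: big1 => m _; rewrite -[RHS](wP (r, m)).1.
  by apply: eq_bigr => j _; rewrite (eq_fweight _ eq_sr).
by rewrite (bigD1 s) //= (wP (r, s)).2 // mul0r.
Qed.

End CycleTypeIndicator.

(** * Linear combinations of modules *)

(** [F] stands for whatever fixes or reads labels: a given boundary labelling in
    a response, the anchors and the function read in a reading. *)
Lemma multilinear_expansion (R : realType) q k (I E J : finType)
    (ends : E -> ('I_k + I) * ('I_k + I))
    (ll : forall b, (ends b).1 != (ends b).2)
    (c : E -> J -> R) (Q : E -> J -> posop R)
    (F : labelling q ('I_k + I)%type -> R) :
  \sum_(phi : {ffun E -> J}) (\prod_b c b (phi b)) *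
     \sum_s F s * edge_weight (G := PhysMod ll (fun b => Q b (phi b))) s =
  \sum_s F s * \prod_b \sum_j c b j *
     fweight (Q b j) ((s (ends b).1)^-1 * s (ends b).2)%g.
Proof.
under eq_bigr do rewrite big_distrr /=.
rewrite exchange_big; apply: eq_bigr => s _ /=.
rewrite bigA_distr_bigA big_distrr; apply: eq_bigr => phi _ /=.
by rewrite mulrCA -big_split.
Qed.

Lemma prod_natb (R : comNzRingType) (I : finType) (P : pred I) :
  \prod_i (P i)%:R = [forall i, P i]%:R :> R.
Proof.
have [/forallP allP|] := boolP [forall i, P i].
  by rewrite big1 // => i _; rewrite allP.
by rewrite negb_forall => /existsP[i /negPf Pi]; rewrite (bigD1 i) //= Pi mul0r.
Qed.

(** * Modules that sum over Gamma *)

Section Gadget.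
Variables (R : realType) (q k : nat) (I0 : finType) (lab : 'I_k + I0 -> 'S_q).

(** The internal vertices are those of I0, which serve as anchors, and one for
    each permutation. *)
Definition gadget_inner : finType := (I0 + 'S_q)%type.

Definition mark (a : 'I_k + I0) : 'I_k + gadget_inner :=
  match a with inl i => inl i | inr j => inr (inl j) end.

Definition copy (x : 'S_q) : 'I_k + gadget_inner := inr (inr x).

(** A constraint compares two distinct permutation vertices, or joins a boundary
    or anchor vertex to the permutation prescribed by [lab]. *)
Definition constraint : finType :=
  ({xy : 'S_q * 'S_q | xy.1 != xy.2} + ('I_k + I0))%type.

Definition constraint_ends (b : constraint) :=
  match b with
  | inl xy => (copy (val xy).1, copy (val xy).2)
  | inr a => (mark a, copy (lab a))
  end.

Definition target (b : constraint) : 'S_q :=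
  match b with inl xy => ((val xy).1^-1 * (val xy).2)%g | inr _ => 1%g end.

(** The second component indexes the parallel edges that carry the factors of
    [cycle_type_indicator]. *)
Lemma gadget_loopless (e : constraint * 'S_q) :
  (constraint_ends e.1).1 != (constraint_ends e.1).2.
Proof.
by case: e => [[[[x y] /= neq_xy]|[i|j]] m].
Qed.

Definition gadget (Q : constraint * 'S_q -> posop R) : physmod R k :=
  PhysMod gadget_loopless Q.

Definition gadget_labels (g : {perm 'S_q}) :
    labelling q ('I_k + gadget_inner)%type :=
  [ffun v => match v with
    | inl i => g (lab (inl i))
    | inr (inl j) => g (lab (inr j))
    | inr (inr x) => g x
    end].

Lemma gadget_labels_mark g a : gadget_labels g (mark a) = g (lab a).
Proof. by case: a => i; rewrite ffunE. Qed.

Lemma gadget_labels_copy g x : gadget_labels g (copy x) = g x.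
Proof. by rewrite ffunE. Qed.

(** The labels at the permutation vertices are the values of a map which
    preserves kappa; it is injective because only the identity has the cycle
    type of the identity, hence it is in Gamma. The other labels are forced. *)
Lemma gadget_labelsP (s : labelling q ('I_k + gadget_inner)%type) :
  [forall b, cycle_type ((s (constraint_ends b).1)^-1 *
                         s (constraint_ends b).2)%g == cycle_type (target b)] =
  (s \in gadget_labels @: Gamma q).
Proof.
apply/forallP/imsetP => [ok|[g g_Gamma ->] b]; last first.
  case: b => [[[x y] /= neq_xy]|a] /=.
    rewrite !gadget_labels_copy; move: g_Gamma.
    by rewrite inE => /forallP/(_ x)/forallP/(_ y).
  by rewrite gadget_labels_mark gadget_labels_copy mulVg.
have ok_kappa x y : kappa (s (copy x)) (s (copy y)) == kappa x y.
  have [->|neq_xy] := eqVneq x y; first by rewrite /kappa !mulVg.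
  exact: ok (inl (exist _ (x, y) neq_xy)).
have s_inj : injective (fun x => s (copy x)).
  move=> x y /eqP; rewrite -cycle_type_mulV_eq1 => /eqP eq_s.
  by apply/eqP; rewrite -cycle_type_mulV_eq1 -eq_s eq_sym ok_kappa.
exists (perm s_inj).
  by rewrite inE; apply/forallP=> x; apply/forallP=> y; rewrite !permE.
have s_mark a : s (mark a) = s (copy (lab a)).
  by apply/eqP; rewrite -cycle_type_mulV_eq1; apply: ok (inr a).
apply/ffunP => -[i|[j|x]]; rewrite ffunE permE //.
- by rewrite -(s_mark (inl i)).
- by rewrite -(s_mark (inr j)).
Qed.

(** The coefficients and modules serve all [F] at once, since both responses and
    readings are of this form. *)
Lemma gadget_sum :
  exists (J : finType) (c : J -> R) (Q : J -> constraint * 'S_q -> posop R),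
  forall F : labelling q ('I_k + gadget_inner)%type -> R,
    \sum_j c j * \sum_s F s * edge_weight (G := gadget (Q j)) s =
    \sum_(g in Gamma q) F (gadget_labels g).
Proof.
have [c [Q cQ]] := cycle_type_indicator R q.
exists {ffun constraint * 'S_q -> bool}.
exists (fun phi : {ffun _} => \prod_e c (target e.1) e.2 (phi e)).
exists (fun (phi : {ffun _}) e => Q (target e.1) e.2 (phi e)) => F.
rewrite (multilinear_expansion gadget_loopless
  (fun e => c (target e.1) e.2) (fun e => Q (target e.1) e.2) F).
under eq_bigr => s _.
  rewrite -(pair_bigA _ (fun b m => \sum_j c (target b) m j *
    fweight (Q (target b) m j) ((s (constraint_ends b).1)^-1 *
                                s (constraint_ends b).2)%g)) /=.
  under eq_bigr do rewrite cQ.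
  rewrite prod_natb gadget_labelsP mulr_natr mulrb.
  over.
rewrite -big_mkcond big_imset // => g h _ _ eq_gh; apply/permP => x.
by rewrite -!gadget_labels_copy eq_gh.
Qed.

End Gadget.

(** * Responses span the invariant functions *)

Lemma responseE (R : realType) q k (G : physmod R k) (p : labelling q 'I_k) :
  response q G p =
  \sum_(s : labelling q (vertex G)) ([ffun i => s (inl i)] == p)%:R *
     edge_weight s.
Proof.
rewrite ffunE; under [RHS]eq_bigr => s _ do rewrite mulr_natl mulrb.
rewrite -big_mkcond /=.
pose join (t : labelling q (inner G)) : labelling q (vertex G) :=
  [ffun v => join_labels p t v].
pose inside (s : labelling q (vertex G)) : labelling q (inner G) :=
  [ffun j => s (inr j)].
rewrite (reindex_onto join inside) /=; last first.
  move=> s /eqP eq_p; apply/ffunP => -[i|j]; rewrite ffunE /= -?eq_p;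
    by rewrite ffunE.
symmetry; apply: eq_big => [t|t _].
  have -> : inside (join t) = t by apply/ffunP => j; rewrite !ffunE.
  rewrite eqxx andbT.
  by apply/eqP/ffunP => i; rewrite !ffunE.
by apply: eq_bigr => b _; rewrite !ffunE.
Qed.

Lemma invariant_functionsP (R : realType) q k
    (h : {ffun labelling q 'I_k -> R^o}) :
  reflect (forall g, g \in Gamma q -> forall p, h (diag p g) = h p)
          (h \in invariant_functions R q k).
Proof.
apply: (iffP forall_inP) => h_inv g g_Gamma; last first.
  by apply/forallP => p; rewrite h_inv.
by move=> p; apply/eqP/(forallP (h_inv g g_Gamma)).
Qed.

(** An element g of Gamma permutes the labellings of the internal vertices, and
    carries every edge to one with the same relative cycle type. *)
Lemma response_invariant (R : realType) q k (G : physmod R k) :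
  response q G \in invariant_functions R q k.
Proof.
apply/invariant_functionsP => g g_Gamma p; rewrite !ffunE.
pose move (h : {perm 'S_q}) (t : labelling q (inner G)) :
  labelling q (inner G) := [ffun j => h (t j)].
rewrite (reindex (move g)) /=; last first.
  exists (move g^-1%g) => t _; apply/ffunP => j;
    by rewrite !ffunE ?permK ?permKV.
apply: eq_bigr => t _; apply: eq_bigr => b _; apply: eq_fweight.
have join_move v : join_labels (diag p g) (move g t) v = g (join_labels p t v).
  by case: v => v; rewrite /= ffunE.
rewrite !join_move; move: g_Gamma; rewrite inE.
by move=> /forallP g_kappa; apply/eqP/(forallP (g_kappa _)).
Qed.

(** This function is the combined response of the modules of [gadget_sum] with
    no anchor and the boundary vertices joined to the values of p. *)
Lemma orbit_count_in_span (R : realType) q k (p : labelling q 'I_k) :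
  [ffun p' => \sum_(g in Gamma q) (diag p g == p')%:R : R^o]
    \in response_span R q k.
Proof.
pose lab (a : 'I_k + void) :=
  match a with inl i => p i | inr v => match v with end end.
have [J [c [Q cQ]]] := gadget_sum R lab.
have -> : [ffun p' => \sum_(g in Gamma q) (diag p g == p')%:R : R^o] =
    \sum_j c j *: response q (gadget lab (Q j)).
  apply/ffunP => p'; rewrite ffunE sum_ffunE.
  under [RHS]eq_bigr => j _ do rewrite ffunE responseE.
  rewrite (cQ (fun s => ([ffun i => s (inl i)] == p')%:R)).
  apply: eq_bigr => g _; congr (_ == _)%:R.
  by apply/ffunP => i; rewrite !ffunE.
by apply: rpred_sum => j _; apply: rpredZ; apply: response_in_span.
Qed.

(** An invariant h is the average over Gamma of its translates; grouped by the
    labelling at which h is evaluated, the average is a combination of the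
    functions of [orbit_count_in_span]. *)
Lemma response_spanE (R : realType) q k :
  response_span R q k =i invariant_functions R q k.
Proof.
move=> h; apply/idP/invariant_functionsP.
  move=> /asboolP[n [c [G ->]]] g g_Gamma p.
  rewrite !sum_ffunE; apply: eq_bigr => i _.
  have /invariant_functionsP inv_Gi := response_invariant q (G i).
  by rewrite 2!(ffunE (fun p => _ *: _ p)) inv_Gi.
move=> h_inv.
have -> : h = #|Gamma q|%:R^-1 *: \sum_p h p *:
    [ffun p' => \sum_(g in Gamma q) (diag p g == p')%:R : R^o].
  apply/ffunP => p'; rewrite ffunE sum_ffunE.
  under eq_bigr => p _ do rewrite !ffunE scaler_sumr.
  rewrite exchange_big /= (eq_bigr (fun=> h p')) => [|g g_Gamma].
    rewrite sumr_const -(scaler_nat _ (h p')) scalerA mulVf ?scale1r //.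
    by rewrite pnatr_eq0 -lt0n cardG_gt0.
  rewrite (bigD1 (diag p' g^-1%g)) //= big1 => [|p neq_p].
    have -> : diag (diag p' g^-1%g) g = p'.
      by apply/ffunP => i; rewrite !ffunE permKV.
    by rewrite h_inv ?groupV // addr0 eqxx; apply: mulr1.
  have [eq_p|_] := eqVneq (diag p g) p'; last exact: mulr0.
  case/eqP: neq_p; rewrite -eq_p.
  by apply/ffunP => i; rewrite !ffunE permK.
by apply/rpredZ/rpred_sum => p _; apply/rpredZ/orbit_count_in_span.
Qed.

(** * Continuations determine the response *)

Section ReadingForm.
Variables (R : realType) (q k : nat).

Lemma reading_form_is_linear (H : physmod R k) (c e : vertex H) :
  linear (reading_form c e : {ffun labelling q 'I_k -> R^o} -> R^o).
Proof.
move=> a h h'; rewrite /reading_form scaler_sumr -big_split.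
apply: eq_bigr => s _; rewrite !ffunE mulrDl; congr (_ + _).
by apply: esym; apply: mulrA.
Qed.
HB.instance Definition _ (H : physmod R k) (c e : vertex H) :=
  GRing.isLinear.Build R {ffun labelling q 'I_k -> R^o} R^o _
    (reading_form c e) (reading_form_is_linear c e).

Lemma response_space_expand (u : response_space R q k) :
  exists (n : nat) (c : 'I_n -> R) (G : 'I_n -> physmod R k),
    u = \sum_i c i *: Response q (G i).
Proof.
have /asboolP[n [c [G eq_u]]] := response_valP u.
exists n, c, G; apply: val_inj; rewrite linear_sum [LHS]eq_u.
by apply: eq_bigr => i _; rewrite linearZ.
Qed.

Lemma supports_reading_form (W : lmodType R)
    (L : {linear response_space R q k -> W}) (u : response_space R q k) :
  supports_continuations L -> L u = 0 ->
  forall (H : physmod R k) (c e : vertex H), c != e ->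
    reading_form c e (val u) = 0.
Proof.
move=> L_supp Lu0 H c e neq_ce; have [l lE] := L_supp H c e neq_ce.
rewrite -[RHS](linear0 l) -Lu0; have [n [a [G ->]]] := response_space_expand u.
rewrite !linear_sum; apply: eq_bigr => i _.
by rewrite !linearZ lE readingE.
Qed.

(** Readings through the modules of [gadget_sum] with anchors joined to the full
    cycle and to 1 isolate the value at p of an element of the kernel. The two
    anchors are distinct vertices even if q = 1 makes the full cycle trivial. *)
Lemma supports_injective (W : lmodType R)
    (L : {linear response_space R q k -> W}) :
  supports_continuations L -> injective L.
Proof.
move=> L_supp; apply: raddf_inj => u Lu0; apply: val_inj; apply/ffunP => p.
have h_inv : val u \in invariant_functions R q k.
  by rewrite -response_spanE response_valP.
set h := val u in h_inv *; rewrite [RHS]ffunE.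
pose lab (a : 'I_k + bool) : 'S_q :=
  match a with inl i => p i | inr j => if j then full_cycle q else 1%g end.
have [J [a [Q aQ]]] := gadget_sum R lab.
pose c : 'I_k + gadget_inner q bool := mark q (inr true).
pose e : 'I_k + gadget_inner q bool := mark q (inr false).
pose fixes (g : {perm 'S_q}) :=
  (g (full_cycle q) == full_cycle q) && (g 1%g == 1%g).
have : \sum_j a j * reading_form (H := gadget lab (Q j)) c e h =
    \sum_(g in Gamma q | fixes g) h p.
  transitivity (\sum_j a j *
    \sum_(s : labelling q ('I_k + gadget_inner q bool)%type)
      ((s c == full_cycle q) && (s e == 1%g))%:R * h [ffun i => s (inl i)] *
      edge_weight (G := gadget lab (Q j)) s).
    apply: eq_bigr => j _; congr (_ * _); rewrite /reading_form big_mkcond.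
    by apply: eq_bigr => s _; case: ifP => _; rewrite ?mul1r ?mul0r.
  rewrite (aQ (fun s : labelling q ('I_k + gadget_inner q bool)%type =>
                        ((s c == full_cycle q) && (s e == 1%g))%:R *
                        h [ffun i => s (inl i)])) big_mkcondr.
  apply: eq_bigr => g g_Gamma; rewrite !gadget_labels_mark /= -/(fixes g).
  case: ifP => _; rewrite ?mul0r // mul1r.
  rewrite -(invariant_functionsP _ h_inv _ g_Gamma p); congr (h _).
  by apply/ffunP => i; rewrite !ffunE.
rewrite big1 => [|j _]; last first.
  by rewrite (supports_reading_form L_supp Lu0) ?mulr0.
rewrite sumr_const -mulr_natl => /esym/eqP; rewrite mulf_eq0 => /orP[|/eqP//].
have id_fixes : (1%g \in Gamma q) && fixes 1%g.
  by rewrite group1 /fixes !perm1 !eqxx.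
by rewrite pnatr_eq0 => /eqP/card0_eq/(_ 1%g); rewrite [_ \in _]id_fixes.
Qed.

End ReadingForm.

(** * Dimension *)

Section OrbitIndicators.
Variables (R : realType) (q k : nat).
Implicit Types (i : 'I_#|boundary_orbits q k|) (p : labelling q 'I_k).

Lemma orbit_index p :
  exists i, forall j : 'I_#|boundary_orbits q k|, (p \in enum_val j) = (j == i).
Proof.
have O_in : orbit (diag_action q k) (Gamma q) p \in boundary_orbits q k.
  exact: imset_f.
exists (enum_rank_in O_in (orbit (diag_action q k) (Gamma q) p)) => j.
apply/idP/eqP => [p_j|->]; last by rewrite enum_rankK_in ?orbit_refl.
apply: enum_val_inj; rewrite enum_rankK_in //.
have /imsetP[p' _ eq_j] := enum_valP j.
by rewrite eq_j in p_j *; apply/esym/orbit_eqP.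
Qed.

Lemma orbit_repr i : exists p, p \in enum_val i.
Proof.
have /imsetP[p _ ->] := enum_valP i.
by exists p; apply: orbit_refl.
Qed.

Lemma orbit_mem_diag i g p :
  g \in Gamma q -> (diag p g \in enum_val i) = (p \in enum_val i).
Proof.
move=> g_Gamma; have /imsetP[p' _ ->] := enum_valP i.
exact: (orbit_actr (diag_action q k)).
Qed.

Definition orbit_indicator i : {ffun labelling q 'I_k -> R^o} :=
  [ffun p => (p \in enum_val i)%:R].

Lemma orbit_indicator_in_span i : orbit_indicator i \in response_span R q k.
Proof.
rewrite response_spanE; apply/invariant_functionsP => g g_Gamma p.
by rewrite !ffunE orbit_mem_diag.
Qed.

Definition orbit_vector i : response_space R q k :=
  ResponseSpace (orbit_indicator_in_span i).

Lemma orbit_sumE (a : 'I_#|boundary_orbits q k| -> R) i p :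
  p \in enum_val i -> val (\sum_j a j *: orbit_vector j) p = a i.
Proof.
have [i' mem_p] := orbit_index p; rewrite mem_p => /eqP ->.
rewrite linear_sum sum_ffunE.
under eq_bigr => j _ do rewrite linearZ !ffunE mem_p.
rewrite (bigD1 i') //= big1 => [|j /negPf ->]; last exact: mulr0.
by rewrite eqxx addr0; apply: mulr1.
Qed.

Lemma orbit_vector_free (a : 'I_#|boundary_orbits q k| -> R) :
  \sum_j a j *: orbit_vector j = 0 -> forall i, a i = 0.
Proof.
move=> a0 i; have [p p_i] := orbit_repr i.
by rewrite -(orbit_sumE a p_i) a0 raddf0 ffunE.
Qed.

Lemma orbit_vector_span (u : response_space R q k) :
  exists a : 'I_#|boundary_orbits q k| -> R, u = \sum_j a j *: orbit_vector j.
Proof.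
have [r r_in] := choice orbit_repr.
exists (fun i => val u (r i)); apply: val_inj; apply/ffunP => p.
have [i mem_p] := orbit_index p.
have p_i : p \in enum_val i by rewrite mem_p.
rewrite (orbit_sumE _ p_i).
have /invariant_functionsP u_inv : val u \in invariant_functions R q k.
  by rewrite -response_spanE response_valP.
have := r_in i; have /imsetP[p' _ eq_i] := enum_valP i.
move: p_i; rewrite eq_i => /orbitP[g g_Gamma <-] /orbitP[g' g'_Gamma <-].
by rewrite !u_inv.
Qed.

End OrbitIndicators.

(** If m > n, the matrix of the coordinates of v on w has a nonzero left kernel,
    and a row of that kernel is a linear dependency of v. *)
Lemma free_le_spanning (F : fieldType) (U : lmodType F) m n
    (v : 'I_m -> U) (w : 'I_n -> U) :
  (forall a : 'I_m -> F, \sum_i a i *: v i = 0 -> forall i, a i = 0) ->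
  (forall i, exists a : 'I_n -> F, v i = \sum_j a j *: w j) ->
  (m <= n)%N.
Proof.
move=> v_free /choice[A vE]; rewrite leqNgt; apply/negP => lt_nm.
pose M : 'M[F]_(m, n) := \matrix_(i, j) A i j.
have : kermx M != 0.
  rewrite -mxrank_eq0 mxrank_ker -lt0n subn_gt0.
  exact: leq_ltn_trans (rank_leq_col M) lt_nm.
move: (kermx M) (mulmx_ker M) => K KM0.
apply/negP; rewrite negbK; apply/eqP/matrixP => l i; rewrite [RHS]mxE.
apply: (v_free (K l)); under eq_bigr do rewrite vE scaler_sumr.
rewrite exchange_big /= big1 // => j _.
under eq_bigr do rewrite scalerA; rewrite -scaler_suml.
have /matrixP/(_ l j) := KM0; rewrite !mxE.
by under eq_bigr do rewrite mxE; move=> ->; rewrite scale0r.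
Qed.

Theorem theoremC4 (R : realType) (q k : nat) (hq : (1 <= q)%N)
    (hk : (1 <= k)%N) :
  [/\ response_span R q k =i invariant_functions R q k,
      forall (W : lmodType R) (L : {linear response_space R q k -> W}),
        supports_continuations L -> injective L
    & (exists (W : lmodType R) (L : {linear response_space R q k -> W}),
         supports_continuations L /\ range_dim L #|boundary_orbits q k|) /\
      (forall (W : lmodType R) (L : {linear response_space R q k -> W})
          (n : nat),
         supports_continuations L -> range_dim L n ->
         (#|boundary_orbits q k| <= n)%N)].
Proof.
split; [exact: response_spanE | exact: supports_injective | split].
  exists (response_space R q k), idfun; split=> [H c e _|].
    by exists (reading_form c e \o val) => G; rewrite readingE.
  exists (@orbit_vector R q k); split=> [i|a|u].
  - by exists (orbit_vector R i).
  - exact: orbit_vector_free.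
  - exact: orbit_vector_span.
move=> W L n L_supp [w [_ _ w_span]].
apply: (free_le_spanning (v := fun i => L (orbit_vector R i)) (w := w)) => //.
move=> a; under eq_bigr do rewrite -linearZ.
rewrite -linear_sum -(raddf0 L) => /(supports_injective L_supp).
exact: orbit_vector_free.
Qed.
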